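(* Let $X$ be an extended quasi-metric space for which $\inf\{d(a,b)\mid a,b\in X,\ a\neq b\}$ is positive. Then $X$ is determined up to isometry by its magnitude cohomology ring $\mathrm{MH}^*_*(X)$. That is, if $X$ and $X'$ are two extended quasi-metric spaces satisfying this condition, and $\mathrm{MH}^*_*(X)\cong\mathrm{MH}^*_*(X')$ as bigraded rings, then $X$ and $X'$ are isometric.
   Context: An extended quasi-metric space is a set $X$ with a function $d\colon X\times X\to[0,\infty]$ such that $d(a,b)=0$ if and only if $a=b$, and $d(a,c)\leq d(a,b)+d(b,c)$ for all $a,b,c$ (symmetry and finiteness of $d$ are not required). The infimum of the empty set is $\infty$. An isometry is a distance-preserving bijection. A $k$-simplex ($k\ge 0$) in $X$ is a tuple $(x_0,\ldots,x_k)\in X^{k+1}$ with $x_{i-1}\neq x_i$ for all $i$; its length is $\ell(x_0,\ldots,x_k)=d(x_0,x_1)+\cdots+d(x_{k-1},x_k)$. For $\ell\in[0,\infty)$, $\mathrm{MC}_{k,\ell}(X)$ is the free abelian group on the $k$-simplices of length $\ell$, with differential $\partial=\sum_{i=1}^{k-1}(-1)^i\partial_i\colon \mathrm{MC}_{k,\ell}(X)\to\mathrm{MC}_{k-1,\ell}(X)$, where $\partial_i(x_0,\ldots,x_k)=(x_0,\ldots,\widehat{x_i},\ldots,x_k)$ if $d(x_{i-1},x_{i+1})=d(x_{i-1},x_i)+d(x_i,x_{i+1})$ and $0$ otherwise. The magnitude cochain complex is $\mathrm{MC}^k_\ell(X)=\mathrm{Hom}(\mathrm{MC}_{k,\ell}(X),\mathbb{Z})$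 with differential $\partial^*\varphi=\varphi\circ\partial$, and $\mathrm{MH}^k_\ell(X)=H^k(\mathrm{MC}^*_\ell(X))$. For $\varphi\in\mathrm{MC}^{k_1}_{\ell_1}(X)$ and $\psi\in\mathrm{MC}^{k_2}_{\ell_2}(X)$, the product $\varphi\cdot\psi\in\mathrm{MC}^{k_1+k_2}_{\ell_1+\ell_2}(X)$ sends a simplex $(x_0,\ldots,x_{k_1+k_2})$ of length $\ell_1+\ell_2$ to $\varphi(x_0,\ldots,x_{k_1})\,\psi(x_{k_1},\ldots,x_{k_1+k_2})$ if $\ell(x_0,\ldots,x_{k_1})=\ell_1$ and $\ell(x_{k_1},\ldots,x_{k_1+k_2})=\ell_2$, and to $0$ otherwise. The unit is the cochain $u\in\mathrm{MC}^0_0(X)$ with $u(x_0)=1$ for every $0$-simplex. This satisfies the Leibniz rule and makes $\mathrm{MH}^*_*(X)$ into an associative unital bigraded ring, the magnitude cohomology ring of $X$. An isomorphism of bigraded rings preserves both gradings. *)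

(* Defs.v *)
From HB Require Import structures.
From mathcomp Require Import all_boot all_order all_algebra.
From mathcomp Require Import ring_quotient generic_quotient.
From mathcomp Require Import boolp classical_sets functions.
From mathcomp Require Import interval_inference reals constructive_ereal ereal.
From mathcomp Require Import freeg zify.

Set Implicit Arguments.
Unset Strict Implicit.
Unset Printing Implicit Defensive.

Import Order.TTheory GRing.Theory Num.Theory.

Local Open Scope ring_scope.

Record extQuasiMetric (R : realType) := ExtQuasiMetric {
  carrier :> Type;
  dist : carrier -> carrier -> \bar R;
  dist_ge0 : forall a b, (0 <= dist a b)%E;
  dist_eq0 : forall a b, dist a b = 0%E <-> a = b;
  dist_triangle : forall a b c, (dist a c <= dist a b + dist b c)%E
}.

HB.instance Definition _ (R : realType) (X : extQuasiMetric R) :=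
  gen_eqMixin (carrier X).
HB.instance Definition _ (R : realType) (X : extQuasiMetric R) :=
  gen_choiceMixin (carrier X).

Definition isometric (R : realType) (X X' : extQuasiMetric R) : Prop :=
  exists f : X -> X',
    bijective f /\ forall a b, dist (f a) (f b) = dist a b.

Definition separation (R : realType) (X : extQuasiMetric R) : \bar R :=
  ereal_inf [set e | exists a b : X, a <> b /\ e = dist a b]%classic.

Definition nngD (R : realType) (l1 l2 : {nonneg R}) : {nonneg R} :=
  (l1%:num + l2%:num)%:nng.

(* A homogeneous element together with its bidegree: this lets elements of the
   propositionally equal bidegrees k1 + (k2 + k3) and (k1 + k2) + k3, and so
   on, be compared. *)
Definition homog (R : realType) (V : nat -> {nonneg R} -> Type) k l (a : V k l)
    : {kl : nat * {nonneg R} & V kl.1 kl.2} :=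
  existT (fun kl => V kl.1 kl.2) (k, l) a.

Record bigradedRing (R : realType) := BigradedRing {
  piece :> nat -> {nonneg R} -> zmodType;
  gone : piece 0 0%:nng;
  gmul : forall k1 l1 k2 l2,
    piece k1 l1 -> piece k2 l2 -> piece (k1 + k2) (nngD l1 l2);
  gmulDl : forall k1 l1 k2 l2 (a a' : piece k1 l1) (b : piece k2 l2),
    gmul (a + a') b = gmul a b + gmul a' b;
  gmulDr : forall k1 l1 k2 l2 (a : piece k1 l1) (b b' : piece k2 l2),
    gmul a (b + b') = gmul a b + gmul a b';
  gmulA : forall k1 l1 k2 l2 k3 l3
      (a : piece k1 l1) (b : piece k2 l2) (c : piece k3 l3),
    homog (V := piece) (gmul a (gmul b c)) =
    homog (V := piece) (gmul (gmul a b) c);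
  gmul1l : forall k l (a : piece k l),
    homog (V := piece) (gmul gone a) = homog (V := piece) a;
  gmul1r : forall k l (a : piece k l),
    homog (V := piece) (gmul a gone) = homog (V := piece) a
}.

Definition bigraded_isomorphic (R : realType) (A B : bigradedRing R) : Prop :=
  exists f : forall k l, {additive A k l -> B k l},
    [/\ forall k l, bijective (f k l),
        f 0 0%:nng (gone A) = gone B
      & forall k1 l1 k2 l2 (a : A k1 l1) (b : A k2 l2),
          f _ _ (gmul a b) = gmul (f k1 l1 a) (f k2 l2 b)].

Section Complex.
Variables (R : realType) (X : extQuasiMetric R).
Implicit Types (k : nat) (l : {nonneg R}).

(* [vert x i] is x_i; it is only meant for i <= k. *)
Definition vert k (x : k.+1.-tuple X) (i : nat) : X := tnth x (inord i).

Definition is_simplex k (x : k.+1.-tuple X) : bool :=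
  [forall i : 'I_k, vert x i != vert x i.+1].

Definition len k (x : k.+1.-tuple X) : \bar R :=
  (\sum_(i < k) dist (vert x i) (vert x i.+1))%E.

Record simplex k l := Simplex {
  simplex_tuple :> k.+1.-tuple X;
  _ : is_simplex simplex_tuple && (len simplex_tuple == l%:num%:E)
}.
HB.instance Definition _ k l := [isSub for @simplex_tuple k l].
HB.instance Definition _ k l := [Choice of simplex k l by <:].

Definition MC k l := {freeg (simplex k l) / int}.
HB.instance Definition _ k l := GRing.Lmodule.on (MC k l).

(* The generator of [MC k l] given by x, and 0 if x is not a k-simplex of
   length l. *)
Definition gen k l (x : k.+1.-tuple X) : MC k l :=
  if insub x is Some s then << (s : simplex k l) >> else 0.

(* Removes x_i from (x_0, ..., x_(k+1)): [bump i j] is j if j < i, else j+1. *)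
Definition face k (i : nat) (x : k.+2.-tuple X) : k.+1.-tuple X :=
  [tuple vert x (bump i j) | j < k.+1].

Definition face_gen k l (i : nat) (s : simplex k.+1 l) : MC k l :=
  if (dist (vert s i.-1) (vert s i.+1) ==
      dist (vert s i.-1) (vert s i) + dist (vert s i) (vert s i.+1))%E
  then gen l (face i s) else 0.

Definition boundary k l : MC k.+1 l -> MC k l :=
  fglift (fun s => \sum_(1 <= i < k.+1) (-1) ^+ i *: face_gen i s).

Lemma boundary_is_zmod_morphism k l : zmod_morphism (@boundary k l).
Proof. exact: lift_is_additive. Qed.
HB.instance Definition _ k l :=
  GRing.isZmodMorphism.Build (MC k.+1 l) (MC k l) (@boundary k l)
    (@boundary_is_zmod_morphism k l).

(* MC^k_l = Hom (MC_(k,l), Z) *)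
Definition cochain k l := {additive MC k l -> int}.
HB.instance Definition _ k l := gen_eqMixin (cochain k l).
HB.instance Definition _ k l := gen_choiceMixin (cochain k l).

Lemma cochainP k l (f g : cochain k l) : f =1 g <-> f = g.
Proof.
split=> [|-> //]; case: f => f [[cf]]; case: g => g [[cg]] /= /funext fg.
subst g; by rewrite (Prop_irrelevance cf cg).
Qed.

Section CochainZmod.
Variables (k : nat) (l : {nonneg R}).

Definition cochain_zero : cochain k l := \0.
Definition cochain_opp (f : cochain k l) : cochain k l := \- f.
Definition cochain_add (f g : cochain k l) : cochain k l := f \+ g.

Lemma cochain_addA : associative cochain_add.
Proof. by move=> f g h; apply/cochainP => c /=; rewrite addrA. Qed.
Lemma cochain_addC : commutative cochain_add.
Proof. by move=> f g; apply/cochainP => c /=; rewrite addrC. Qed.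
Lemma cochain_add0 : left_id cochain_zero cochain_add.
Proof. by move=> f; apply/cochainP => c /=; rewrite add0r. Qed.
Lemma cochain_addN : left_inverse cochain_zero cochain_opp cochain_add.
Proof. by move=> f; apply/cochainP => c /=; rewrite addNr. Qed.

HB.instance Definition _ := GRing.isZmodule.Build (cochain k l)
  cochain_addA cochain_addC cochain_add0 cochain_addN.
End CochainZmod.

Definition coboundary k l (f : cochain k l) : cochain k.+1 l :=
  f \o @boundary k l.

Lemma coboundary_is_zmod_morphism k l : zmod_morphism (@coboundary k l).
Proof. by move=> f g; apply/cochainP. Qed.
HB.instance Definition _ k l :=
  GRing.isZmodMorphism.Build (cochain k l) (cochain k.+1 l) (@coboundary k l)
    (@coboundary_is_zmod_morphism k l).

Definition lin_ext k l (h : simplex k l -> int) : MC k l -> int :=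
  fglift (M := int^o) h.

Lemma lin_ext_is_zmod_morphism k l (h : simplex k l -> int) :
  zmod_morphism (lin_ext h).
Proof. exact: (@lift_is_additive int (simplex k l) int^o h). Qed.
HB.instance Definition _ k l (h : simplex k l -> int) :=
  GRing.isZmodMorphism.Build (MC k l) int (lin_ext h) (lin_ext_is_zmod_morphism h).

(* [front] is (x_0, ..., x_k1) and [back] is (x_k1, ..., x_(k1 + k2)). *)
Definition front k1 k2 (x : (k1 + k2).+1.-tuple X) : k1.+1.-tuple X :=
  [tuple vert x i | i < k1.+1].
Definition back k1 k2 (x : (k1 + k2).+1.-tuple X) : k2.+1.-tuple X :=
  [tuple vert x (k1 + i) | i < k2.+1].

(* The length conditions in the product are built into [gen], which is 0 on a
   tuple of the wrong length. *)
Definition cochain_mul k1 l1 k2 l2 (f : cochain k1 l1) (g : cochain k2 l2) :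
    cochain (k1 + k2) (nngD l1 l2) :=
  lin_ext (fun s => f (gen l1 (front s)) * g (gen l2 (back s))).

Definition cochain_one : cochain 0 0%:nng := lin_ext (fun=> 1).

(* In the proofs, simplices are handled through sequences u : nat -> X extending them. *)

Definition tup k (u : nat -> X) : k.+1.-tuple X := [tuple u i | i < k.+1].

Lemma vert_tup k (u : nat -> X) i : (i <= k)%N -> vert (tup k u) i = u i.
Proof. by move=> ik; rewrite /vert tnth_mktuple inordK. Qed.

Lemma tup_vert k (x : k.+1.-tuple X) : tup k (vert x) = x.
Proof. by apply: eq_from_tnth => i; rewrite tnth_mktuple /vert inord_val. Qed.

Lemma eq_tup k (u v : nat -> X) :
  (forall i, (i <= k)%N -> u i = v i) -> tup k u = tup k v.
Proof.
by move=> uv; apply: eq_from_tnth => i; rewrite !tnth_mktuple uv // -ltnS.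
Qed.

Definition nrep k (u : nat -> X) := is_simplex (tup k u).
Definition seqlen (k : nat) (u : nat -> X) : \bar R := (\sum_(0 <= i < k) dist (u i) (u i.+1))%E.
Definition is_simp k l (u : nat -> X) := nrep k u && (seqlen k u == l%:num%:E).
Definition shift (n : nat) (u : nat -> X) (i : nat) := u (n + i)%N.
Definition omit (n : nat) (u : nat -> X) (i : nat) := u (bump n i).
Definition aligned (n : nat) (u : nat -> X) :=
  (dist (u n.-1) (u n.+1) == dist (u n.-1) (u n) + dist (u n) (u n.+1))%E.
Definition ev k l (f : cochain k l) (u : nat -> X) : int := f (gen l (tup k u)).

Lemma nrepP k u :
  reflect (forall i, (i < k)%N -> u i != u i.+1) (nrep k u).
Proof.
apply: (iffP forallP) => [H i ik|H i].
  by have := H (Ordinal ik); rewrite /= !vert_tup // ltnW.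
by rewrite !vert_tup //; [exact: H|exact: ltnW].
Qed.

Lemma len_tup k u : len (tup k u) = seqlen k u.
Proof.
rewrite /seqlen big_mkord; apply: eq_bigr => i _.
by rewrite !vert_tup //; exact: ltnW.
Qed.

Lemma ev_eq k l (f : cochain k l) u v :
  (forall i, (i <= k)%N -> u i = v i) -> ev f u = ev f v.
Proof. by move=> uv; rewrite /ev (eq_tup uv). Qed.

Lemma ev_nsimp k l (f : cochain k l) u : ~~ is_simp k l u -> ev f u = 0.
Proof. by move=> h; rewrite /ev /gen insubN ?raddf0 // len_tup. Qed.

Lemma gen_simplex k l (s : simplex k l) : gen l s = << s >>.
Proof. by rewrite /gen valK. Qed.

Lemma ev_simplex k l (f : cochain k l) (s : simplex k l) :
  ev f (vert s) = f << s >>.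
Proof. by rewrite /ev tup_vert gen_simplex. Qed.

Lemma cochain_eq k l (f g : cochain k l) :
  (forall s : simplex k l, f << s >> = g << s >>) -> f = g.
Proof.
move=> fg; apply/cochainP => c.
have hz m (s : simplex k l) : << m *g s >> = << s >> *~ m :> MC k l.
  by rewrite freegU_mulz intz.
rewrite -[c]freeg_sumE !raddf_sum; apply: eq_bigr => s _.
by rewrite hz !raddfMz fg.
Qed.

Lemma evP k l (f g : cochain k l) : ev f =1 ev g -> f = g.
Proof. by move=> fg; apply: cochain_eq => s; rewrite -!ev_simplex. Qed.

Lemma is_simp_simplex k l u : is_simp k l u -> {s : simplex k l | val s = tup k u}.
Proof.
rewrite /is_simp /nrep -len_tup => h.
by exists (Simplex h).
Qed.

Lemma lin_extU k l (h : simplex k l -> int) (s : simplex k l) : lin_ext h << s >> = h s.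
Proof. by rewrite /lin_ext liftU scale1r. Qed.

Lemma ev_add k l (f g : cochain k l) u : ev (f + g) u = ev f u + ev g u.
Proof. by []. Qed.
Lemma ev_opp k l (f : cochain k l) u : ev (- f) u = - ev f u.
Proof. by []. Qed.
Lemma ev0 k l u : ev (0 : cochain k l) u = 0.
Proof. by []. Qed.

Lemma ev_val k l (f : cochain k l) u (s : simplex k l) :
  val s = tup k u -> ev f u = f << s >>.
Proof. by rewrite /ev => <-; rewrite gen_simplex. Qed.

Lemma ev_one u : ev cochain_one u = 1.
Proof.
have /is_simp_simplex[s su] : is_simp 0 0%:nng u.
  by rewrite /is_simp /seqlen big_nil eqxx andbT; apply/nrepP.
by rewrite (ev_val _ su) /= lin_extU.
Qed.

Lemma nrep_cat k1 k2 u :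
  nrep (k1 + k2) u = nrep k1 u && nrep k2 (shift k1 u).
Proof.
apply/nrepP/andP => [H|[/nrepP H1 /nrepP H2] i ik].
  split; apply/nrepP => i ik; first by apply: H; rewrite ltn_addr.
  by rewrite /shift addnS; apply: H; rewrite ltn_add2l.
have [ik1|k1i] := ltnP i k1; first exact: H1.
have := H2 (i - k1)%N; rewrite /shift addnS subnKC //; apply.
by rewrite ltn_subLR.
Qed.

Lemma seqlen_cat k1 k2 u : (seqlen (k1 + k2) u = seqlen k1 u + seqlen k2 (shift k1 u))%E.
Proof.
rewrite /seqlen (big_cat_nat (n := k1)) //= ?leq_addr //; congr (_ + _)%E.
rewrite -{1}[k1]add0n big_addn addKn; apply: eq_bigr => i _.
by rewrite /shift addnS addnC.
Qed.

Lemma is_simp_cat k1 l1 k2 l2 u : is_simp k1 l1 u -> is_simp k2 l2 (shift k1 u) ->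
  is_simp (k1 + k2) (nngD l1 l2) u.
Proof.
move=> /andP[n1 /eqP L1] /andP[n2 /eqP L2].
by rewrite /is_simp nrep_cat n1 n2 seqlen_cat L1 L2 eqxx.
Qed.

Lemma ev_mul k1 l1 k2 l2 (f : cochain k1 l1) (g : cochain k2 l2) u :
  ev (cochain_mul f g) u = ev f u * ev g (shift k1 u).
Proof.
have [/is_simp_simplex[s su]|nok] := boolP (is_simp (k1 + k2) (nngD l1 l2) u).
  rewrite (ev_val _ su) /= lin_extU /ev; congr (f (gen _ _) * g (gen _ _)).
    apply: eq_from_tnth => i; rewrite !tnth_mktuple su vert_tup //.
    by rewrite (leq_trans _ (leq_addr _ _)) // -ltnS.
  apply: eq_from_tnth => i; rewrite !tnth_mktuple su vert_tup //.
  by rewrite leq_add2l -ltnS.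
rewrite ev_nsimp //.
have [h1|/ev_nsimp->] := boolP (is_simp k1 l1 u); last by rewrite mul0r.
have [h2|/ev_nsimp->] := boolP (is_simp k2 l2 (shift k1 u)); last by rewrite mulr0.
by rewrite is_simp_cat in nok.
Qed.

Definition bdsum k l (f : cochain k l) (u : nat -> X) : int :=
  \sum_(1 <= i < k.+1) (-1) ^+ i * (if aligned i u then ev f (omit i u) else 0).

Lemma cochainZ k l (f : cochain k l) (a : int) (c : MC k l) :
  f (a *: c) = a * f c.
Proof. by rewrite -{1}[a]intz scaler_int raddfMz mulrzz mulrC. Qed.

Lemma ev_coboundary_simp k l (f : cochain k l) u :
  is_simp k.+1 l u -> ev (coboundary f) u = bdsum f u.
Proof.
move=> /is_simp_simplex[s su]; rewrite (ev_val _ su) /= /boundary liftU scale1r.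
rewrite raddf_sum big_nat [RHS]big_nat; apply: eq_bigr => i /andP[i0 ik].
rewrite cochainZ; congr (_ * _); rewrite /face_gen /aligned -[simplex_tuple s]/(val s) su.
rewrite !vert_tup; try by lia.
case: ifP => _; last by rewrite raddf0.
rewrite /ev; congr (f (gen _ _)).
apply: eq_from_tnth => j; rewrite !tnth_mktuple vert_tup // /bump.
by have := ltn_ord j; lia.
Qed.

Lemma seqlen_omit k n u : (0 < n < k.+1)%N -> aligned n u -> seqlen k (omit n u) = seqlen k.+1 u.
Proof.
move=> /andP[n0 nk] /eqP cn.
have nk' : (n.-1 <= k)%N by lia.
rewrite /seqlen (big_cat_nat (n := n.-1)) //= (big_cat_nat (m := 0%N) (n := n.-1) (p := k.+1)) //=; last by lia.
congr (_ + _)%E.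
  apply: eq_big_nat => i /andP[_ ?]; rewrite /omit /bump.
  by congr dist; congr u; lia.
rewrite big_ltn; last by lia.
rewrite [RHS]big_ltn; last by lia.
rewrite prednK // [in RHS]big_ltn; last by lia.
rewrite addeA; congr (_ + _)%E.
  rewrite -cn /omit /bump; congr dist; congr u; lia.
rewrite big_add1; apply: eq_big_nat => i /andP[? ?]; rewrite /omit /bump.
by congr dist; congr u; lia.
Qed.

Lemma ev_coboundary k l (f : cochain k l) u :
  nrep k.+1 u -> ev (coboundary f) u = bdsum f u.
Proof.
move=> nu; have [/ev_coboundary_simp//|nok] := boolP (is_simp k.+1 l u).
rewrite ev_nsimp // /bdsum big_nat big1 // => i ik.
case: ifP => [ci|_]; last by rewrite mulr0.
rewrite ev_nsimp ?mulr0 //; apply: contra nok => /andP[_].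
by rewrite /is_simp nu (seqlen_omit ik).
Qed.

Lemma leibniz k1 l1 k2 l2 (f : cochain k1 l1) (g : cochain k2 l2) u :
  ev (coboundary (cochain_mul f g)) u =
  ev (cochain_mul (coboundary f) g) u +
  (-1) ^+ k1 * ev (cochain_mul f (coboundary g)) u.
Proof.
rewrite !ev_mul.
have [nu|nnu] := boolP (nrep (k1 + k2).+1 u); last first.
  rewrite ev_nsimp ?/is_simp ?(negbTE nnu) //.
  have [h1|/ev_nsimp->] := boolP (is_simp k1.+1 l1 u); last first.
    rewrite mul0r add0r.
    have [h1|/ev_nsimp->] := boolP (is_simp k1 l1 u); last by rewrite mul0r mulr0.
    have [h2|/ev_nsimp->] := boolP (is_simp k2.+1 l2 (shift k1 u)); last by rewrite !mulr0.
    by have /andP[] := is_simp_cat h1 h2; rewrite addnS (negbTE nnu).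
  have [h2|/ev_nsimp->] := boolP (is_simp k2 l2 (shift k1.+1 u)).
    by have /andP[] := is_simp_cat h1 h2; rewrite addSn (negbTE nnu).
  rewrite mulr0 add0r.
  have [h3|/ev_nsimp->] := boolP (is_simp k1 l1 u); last by rewrite mul0r mulr0.
  have [h4|/ev_nsimp->] := boolP (is_simp k2.+1 l2 (shift k1 u)); last by rewrite !mulr0.
  by have /andP[] := is_simp_cat h3 h4; rewrite addnS (negbTE nnu).
have nu2 : nrep k2.+1 (shift k1 u).
  by move: nu; rewrite -addnS nrep_cat => /andP[].
have nu1 : nrep k1.+1 u.
  by move: nu; rewrite -addSn nrep_cat => /andP[].
rewrite !ev_coboundary // /bdsum (big_cat_nat (n := k1.+1)) //; last by rewrite ltnS leq_addr.
congr (_ + _).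
  rewrite mulr_suml; apply: eq_big_nat => i /andP[i0 ik].
  case: ifP => _; last by rewrite mulr0 mul0r.
  rewrite ev_mul mulrA; congr (_ * _).
  by apply: ev_eq => j _; rewrite /shift /omit /bump; congr u; lia.
rewrite !mulr_sumr -{1}[k1.+1]addn1 addnC big_addn -addnS addKn.
apply: eq_big_nat => i /andP[i0 ik].
rewrite addnC exprD -mulrA; congr (_ * _); rewrite [RHS]mulrCA; congr (_ * _).
have -> : aligned (k1 + i) u = aligned i (shift k1 u).
  by rewrite /aligned /shift addnS; have -> : (k1 + i).-1 = (k1 + i.-1)%N by lia.
case: ifP => _; last by rewrite mulr0.
rewrite ev_mul; congr (_ * _).
  by apply: ev_eq => j jk; rewrite /omit /bump; congr u; lia.
by apply: ev_eq => j _; rewrite /shift /omit /bump; congr u; lia.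
Qed.

Definition is_cocycle k l : {pred cochain k l} :=
  fun f => coboundary f == 0.

Lemma is_cocycle_zmod_closed k l : zmod_closed (@is_cocycle k l).
Proof.
split=> [|f g]; rewrite !unfold_in; first by rewrite raddf0.
by move=> /eqP f0 /eqP g0; rewrite raddfB /= f0 g0 subr0.
Qed.
HB.instance Definition _ k l :=
  GRing.isZmodClosed.Build (cochain k l) (@is_cocycle k l)
    (@is_cocycle_zmod_closed k l).

Record cocycle k l := Cocycle {
  cocycle_val :> cochain k l;
  _ : cocycle_val \in @is_cocycle k l
}.
HB.instance Definition _ k l := [isSub for @cocycle_val k l].
HB.instance Definition _ k l := [Choice of cocycle k l by <:].
HB.instance Definition _ k l := [SubChoice_isSubZmodule of cocycle k l by <:].

(* There are no cochains in degree -1, so 0 is the only coboundary in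
   degree 0. *)
Definition is_exact k l : {pred cocycle k l} :=
  match k return {pred cocycle k l} with
  | 0 => fun z => z == 0
  | k'.+1 => fun z => `[< exists h : cochain k' l, val z = coboundary h >]
  end.

Lemma is_exact_zmod_closed k l : zmod_closed (@is_exact k l).
Proof.
case: k => [|k]; split=> [|x y]; rewrite !unfold_in //=.
- by move=> /eqP-> /eqP->; rewrite subr0.
- by apply/asboolP; exists 0; rewrite raddf0.
- move=> /asboolP[f xf] /asboolP[g yg]; apply/asboolP; exists (f - g).
  by rewrite !raddfB /= -xf -yg.
Qed.
HB.instance Definition _ k l :=
  GRing.isZmodClosed.Build (cocycle k l) (@is_exact k l)
    (@is_exact_zmod_closed k l).

Definition MH k l := Quotient.quot (@is_exact k l).
HB.instance Definition _ k l := GRing.Zmodule.on (MH k l).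
HB.instance Definition _ k l :=
  EqQuotient.on (MH k l).

Definition MHclass k l (z : cocycle k l) : MH k l := \pi_(MH k l)%qT z.

Lemma exact_intro k l (z : cocycle k l) k' (h : cochain k' l) :
  k = k'.+1 -> ev z =1 ev (coboundary h) -> z \in @is_exact k l.
Proof.
move=> ek; subst k => zh; rewrite unfold_in; apply/asboolP; exists h.
exact: evP.
Qed.

Lemma exact_elim k l (z : cocycle k l) : z \in @is_exact k l ->
  z = 0 \/ exists k' (h : cochain k' l),
    k = k'.+1 /\ ev z =1 ev (coboundary h).
Proof.
case: k z => [|k] z; rewrite unfold_in /=; first by move=> /eqP ->; left.
by move=> /asboolP[h zh]; right; exists k, h; split => // u; rewrite -zh.
Qed.

Lemma cocycle_coboundary k l (z : cocycle k l) : coboundary z = 0.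
Proof. by apply/eqP; have := valP z; rewrite unfold_in. Qed.

Lemma cocycle_mul_subproof k1 l1 k2 l2 (z : cocycle k1 l1) (w : cocycle k2 l2) :
  cochain_mul z w \in @is_cocycle (k1 + k2) (nngD l1 l2).
Proof.
rewrite unfold_in; apply/eqP/evP => u; rewrite leibniz !ev_mul.
by rewrite !cocycle_coboundary !ev0 mul0r !mulr0 addr0.
Qed.
Definition cocycle_mul k1 l1 k2 l2 (z : cocycle k1 l1) (w : cocycle k2 l2) :
  cocycle (k1 + k2) (nngD l1 l2) := Cocycle (cocycle_mul_subproof z w).

Lemma cocycle_one_subproof : cochain_one \in @is_cocycle 0 0%:nng.
Proof.
rewrite unfold_in; apply/eqP/cochain_eq => s.
by rewrite -ev_simplex ev_coboundary ?/bdsum ?big_geq // /nrep tup_vert;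
  have /andP[] := valP s.
Qed.
Definition cocycle_one : cocycle 0 0%:nng := Cocycle cocycle_one_subproof.

Definition MHone : MH 0 0%:nng := MHclass cocycle_one.

Definition MHmul k1 l1 k2 l2 (a : MH k1 l1) (b : MH k2 l2) :
    MH (k1 + k2) (nngD l1 l2) :=
  MHclass (cocycle_mul (repr a) (repr b)).

Lemma MHclass_eq k l (x y : cocycle k l) :
  MHclass x = MHclass y <-> x - y \in @is_exact k l.
Proof. by rewrite Quotient.idealrBE; split=> [/eqP|/eqP]. Qed.

Lemma MHclassK k l (a : MH k l) : MHclass (repr a) = a.
Proof. exact: reprK. Qed.

Lemma ev_cocycle_mul k1 l1 k2 l2 (z : cocycle k1 l1) (w : cocycle k2 l2) u :
  ev (cocycle_mul z w) u = ev z u * ev w (shift k1 u).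
Proof. exact: ev_mul. Qed.

Lemma ev_cocycleB k l (z w : cocycle k l) u : ev (z - w) u = ev z u - ev w u.
Proof. by []. Qed.

Lemma ev_cocycleD k l (z w : cocycle k l) u : ev (z + w) u = ev z u + ev w u.
Proof. by []. Qed.

Lemma cocycle_eq k l (z w : cocycle k l) : ev z =1 ev w -> z = w.
Proof. by move=> zw; apply/val_inj/evP. Qed.

Lemma exact_mull k1 l1 k2 l2 (z : cocycle k1 l1) (w : cocycle k2 l2) :
  z \in @is_exact k1 l1 -> cocycle_mul z w \in @is_exact (k1 + k2) (nngD l1 l2).
Proof.
move=> /exact_elim[->|[k' [h [ek zh]]]].
  rewrite (_ : cocycle_mul _ _ = 0) ?rpred0 //; apply: cocycle_eq => u.
  by rewrite ev_cocycle_mul !ev0 mul0r.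
apply: (@exact_intro _ _ _ (k' + k2) (cochain_mul h w)).
  by rewrite ek addSn.
move=> u; rewrite leibniz ev_cocycle_mul zh !ev_mul cocycle_coboundary ev0.
by rewrite !mulr0 addr0 ek.
Qed.

Lemma exact_mulr k1 l1 k2 l2 (z : cocycle k1 l1) (w : cocycle k2 l2) :
  w \in @is_exact k2 l2 -> cocycle_mul z w \in @is_exact (k1 + k2) (nngD l1 l2).
Proof.
move=> /exact_elim[->|[k' [h [ek wh]]]].
  rewrite (_ : cocycle_mul _ _ = 0) ?rpred0 //; apply: cocycle_eq => u.
  by rewrite ev_cocycle_mul !ev0 mulr0.
have e u : ev (coboundary (cochain_mul z h)) u =
           (-1) ^+ k1 * ev (cocycle_mul z w) u.
  rewrite leibniz !ev_mul cocycle_coboundary ev0 mul0r add0r.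
  by rewrite wh.
have e1 : (k1 + k2 = (k1 + k').+1)%N by rewrite ek addnS.
move: e; rewrite -signr_odd; case: (odd k1) => e.
  apply: (@exact_intro _ _ _ _ (- cochain_mul z h)) => // u.
  by rewrite raddfN ev_opp e expr1 mulN1r opprK.
by apply: (@exact_intro _ _ _ _ (cochain_mul z h)) => // u; rewrite e mul1r.
Qed.

Lemma MHmul_class k1 l1 k2 l2 (z : cocycle k1 l1) (w : cocycle k2 l2) :
  MHmul (MHclass z) (MHclass w) = MHclass (cocycle_mul z w).
Proof.
set z' := repr (MHclass z); set w' := repr (MHclass w).
have zz' : z' - z \in @is_exact k1 l1 by apply/MHclass_eq; rewrite MHclassK.
have ww' : w' - w \in @is_exact k2 l2 by apply/MHclass_eq; rewrite MHclassK.
apply/MHclass_eq.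
have -> : cocycle_mul z' w' - cocycle_mul z w =
          cocycle_mul (z' - z) w' + cocycle_mul z (w' - w).
  apply: cocycle_eq => u.
  rewrite ev_cocycleB ev_cocycleD !ev_cocycle_mul !ev_cocycleB.
  by rewrite mulrBl mulrBr addrA subrK.
by apply: rpredD; [exact: exact_mull|exact: exact_mulr].
Qed.

Lemma MHclassD k l (x y : cocycle k l) :
  MHclass (x + y) = MHclass x + MHclass y.
Proof. by rewrite /MHclass raddfD. Qed.

Lemma MHmulDl k1 l1 k2 l2 (a a' : MH k1 l1) (b : MH k2 l2) :
  MHmul (a + a') b = MHmul a b + MHmul a' b.
Proof.
rewrite -(MHclassK a) -(MHclassK a') -(MHclassK b) -MHclassD !MHmul_class.
rewrite -MHclassD; congr MHclass; apply: cocycle_eq => u.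
by rewrite !(ev_cocycleD, ev_cocycle_mul) mulrDl.
Qed.

Lemma MHmulDr k1 l1 k2 l2 (a : MH k1 l1) (b b' : MH k2 l2) :
  MHmul a (b + b') = MHmul a b + MHmul a b'.
Proof.
rewrite -(MHclassK a) -(MHclassK b) -(MHclassK b') -MHclassD !MHmul_class.
rewrite -MHclassD; congr MHclass; apply: cocycle_eq => u.
by rewrite !(ev_cocycleD, ev_cocycle_mul) mulrDr.
Qed.

Lemma homog_class k l k' l' (z : cocycle k l) (w : cocycle k' l') :
  k = k' -> l = l' -> ev z =1 ev w ->
  homog (V := MH) (MHclass z) = homog (V := MH) (MHclass w).
Proof. by move=> ek el; subst k' l' => /cocycle_eq->. Qed.

Lemma MHmulA k1 l1 k2 l2 k3 l3 (a : MH k1 l1) (b : MH k2 l2) (c : MH k3 l3) :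
  homog (V := MH) (MHmul a (MHmul b c)) = homog (V := MH) (MHmul (MHmul a b) c).
Proof.
rewrite -(MHclassK a) -(MHclassK b) -(MHclassK c) !MHmul_class.
apply: homog_class; rewrite ?addnA //; first by apply: val_inj; rewrite /= addrA.
move=> u; rewrite !ev_cocycle_mul mulrA; congr (_ * _).
by apply: ev_eq => i _; rewrite /shift addnA.
Qed.

Lemma MHmul1l k l (a : MH k l) : homog (V := MH) (MHmul MHone a) = homog (V := MH) a.
Proof.
rewrite -(MHclassK a) MHmul_class; apply: homog_class => //.
  by apply: val_inj; rewrite /= add0r.
by move=> u; rewrite ev_cocycle_mul ev_one mul1r; apply: ev_eq.
Qed.

Lemma MHmul1r k l (a : MH k l) : homog (V := MH) (MHmul a MHone) = homog (V := MH) a.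
Proof.
rewrite -(MHclassK a) MHmul_class; apply: homog_class; rewrite ?addn0 //.
  by apply: val_inj; rewrite /= addr0.
by move=> u; rewrite ev_cocycle_mul ev_one mulr1.
Qed.

Definition magnitude_cohomology : bigradedRing R :=
  @BigradedRing R (fun k l => MH k l) MHone MHmul
    MHmulDl MHmulDr MHmulA MHmul1l MHmul1r.

End Complex.

(* Main.v *)
Require Import Defs.
From mathcomp Require Import all_boot all_order all_algebra.
From mathcomp Require Import reals constructive_ereal ereal.
From mathcomp Require Import generic_quotient boolp classical_sets.
From mathcomp Require Import interval_inference.

(** The ring remembers enough to rebuild the metric from its short edges.

    A cochain of degree 0 has coboundary 0, as differentials omit interior
    vertices only. So in degrees 0 and 1 a cohomology class is a cocycle, that
    is, a function on simplices ([class_val]). In bidegree (0, 0) these are all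
    functions on points, and the indicator [point_class] of a point recovers the
    point. An isomorphism F and its inverse preserve nonvanishing of products;
    this alone forces F [point_class a] to be supported at a single point a',
    and a to be determined by a' ([corr_inj], [corr_sym]). This yields the
    bijection of the two spaces.

    In bidegree (1, l) a cocycle is a function on the pairs at distance l that
    vanishes on the pairs having a third point strictly between them.
    Hence if a and b are adjacent, that is, have no point strictly between, and
    dist a b = l is finite, then the indicator of (a, b) is a cocycle whose
    product with the indicators of a (on the left) and b (on the right) is not
    zero. Transported by F, this nonzero product has to be carried by the pair
    (a', b'), which therefore has length l too ([adjacent_dist_corr]).

    Finally, as the separation is positive, a pair at finite distance can be
    subdivided only finitely often, so that every such distance is a sum of
    distances of adjacent pairs along a chain ([geodesic_ind]). By the triangle
    inequality the bijection does not increase distances; its inverse does not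
    either, by symmetry. *)

Set Implicit Arguments.
Unset Strict Implicit.
Unset Printing Implicit Defensive.

Import Order.TTheory GRing.Theory Num.Theory.

Local Open Scope ring_scope.

(** * Geodesic chains *)

Definition adjacent (R : realType) (X : extQuasiMetric R) (a b : X) : Prop :=
  a <> b /\
  forall c, c <> a -> c <> b -> dist a b <> (dist a c + dist c b)%E.

Lemma separation_gt0_bound (R : realType) (X : extQuasiMetric R) :
  (0 < separation X)%E ->
  exists2 e : R, 0 < e & forall a b : X, a <> b -> (e%:E <= dist a b)%E.
Proof.
move=> s0.
have lb (a b : X) : a <> b -> (separation X <= dist a b)%E.
  by move=> ab; apply: ereal_inf_lbound; exists a, b.
case: (separation X) s0 lb => [e| |] // s0 lb.
  by exists e.
(* The separation is infinite: any bound will do. *)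
exists 1 => // a b ab; exact: le_trans (leey _) (lb _ _ ab).
Qed.

(** A nontrivial subdivision takes at least the separation off the distance,
    so subdividing stops; the induction is on a bound for the distance measured
    in units of the separation. *)
Lemma geodesic_ind (R : realType) (X : extQuasiMetric R)
    (sepX : (0 < separation X)%E) (P : X -> X -> Prop) :
  (forall a, P a a) ->
  (forall a b, adjacent a b -> (dist a b < +oo)%E -> P a b) ->
  (forall a b c, dist a b = (dist a c + dist c b)%E ->
    P a c -> P c b -> P a b) ->
  forall a b, (dist a b < +oo)%E -> P a b.
Proof.
move=> Prefl Padj Psplit.
have [e e0 sep] := separation_gt0_bound sepX.
have step n : forall a b, (dist a b < (e *+ n)%R%:E)%E -> P a b.
  elim: n => [|n IHn] a b dab.
    by have := le_lt_trans (dist_ge0 a b) dab; rewrite mulr0n ltxx.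
  have [->|ab] := pselect (a = b); first exact: Prefl.
  have dfin : (dist a b < +oo)%E by exact: lt_trans dab (ltry _).
  have [adj|nadj] := pselect (adjacent a b); first exact: Padj.
  have [c [ca cb dacb]] : exists c,
      [/\ c <> a, c <> b & dist a b = (dist a c + dist c b)%E].
    apply: contrapT => nc; apply: nadj; split=> // c ca cb dacb.
    by apply: nc; exists c.
  have ac := sep a c (nesym ca); have bc := sep c b cb.
  apply: (Psplit a b c dacb); apply: IHn; move: dab; rewrite dacb;
    move: (dist a c) (dist c b) ac bc => [x| |] [y| |] //=;
    rewrite -?EFinD ?lee_fin ?lte_fin mulrS => ex ey xy.
  - by rewrite -(ltrD2l e) (le_lt_trans _ xy) // addrC lerD2l.
  - by rewrite -(ltrD2l e) (le_lt_trans _ xy) // lerD2r.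
move=> a b dab.
have [n dn] : exists n, (dist a b < (e *+ n)%R%:E)%E.
  move: (dist a b) (dist_ge0 a b) dab => [x| |] // x0 _.
  exists (Num.truncn (x / e)).+1.
  by rewrite lte_fin -mulr_natl -ltr_pdivrMr // truncnS_gt.
exact: step dn.
Qed.

(** * Cohomology in degrees 0 and 1 *)

Section LowDegree.
Variables (R : realType) (X : extQuasiMetric R).

Lemma ev_coboundary0 (l : {nonneg R}) (h : cochain X 0 l) u :
  ev (coboundary h) u = 0.
Proof.
have [simp|nsimp] := boolP (is_simp 1 l u); last exact: ev_nsimp.
by rewrite ev_coboundary_simp // /bdsum big_geq.
Qed.

Lemma exact_low_degree k (l : {nonneg R}) (z : cocycle X k l) :
  (k <= 1)%N -> z \in @is_exact R X k l -> z = 0.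
Proof.
move=> k1 /exact_elim[//|[k' [h [ek zh]]]]; subst k.
case: k' z k1 h zh => // z _ h zh.
by apply: cocycle_eq => u; rewrite zh ev_coboundary0.
Qed.

(** In degrees 0 and 1, where classes have only one representative, this is the
    value of that representative on (u 0, ..., u k). *)
Definition class_val k (l : {nonneg R}) (a : MH X k l) (u : nat -> X) : int :=
  ev (repr a) u.

Lemma class_val_class k (l : {nonneg R}) (z : cocycle X k l) u :
  (k <= 1)%N -> class_val (MHclass z) u = ev z u.
Proof.
move=> k1; apply/eqP; rewrite -subr_eq0 -ev_cocycleB; apply/eqP.
rewrite (exact_low_degree (z := repr (MHclass z) - z)) //.
by apply/MHclass_eq; rewrite MHclassK.
Qed.

Lemma class_val_eq0 k (l : {nonneg R}) (a : MH X k l) :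
  (forall u, class_val a u = 0) -> a = 0.
Proof.
move=> a0; rewrite -(MHclassK a) (_ : repr a = 0); last exact: cocycle_eq.
by rewrite /MHclass raddf0.
Qed.

Lemma class_val_neq0 k (l : {nonneg R}) (a : MH X k l) :
  a <> 0 -> exists u, class_val a u <> 0.
Proof.
by move=> a0; apply/existsNP => va; apply: a0; exact: class_val_eq0.
Qed.

Lemma class_val0 k (l : {nonneg R}) u :
  (k <= 1)%N -> class_val (0 : MH X k l) u = 0.
Proof.
by move=> k1; rewrite (_ : 0 = MHclass 0) ?class_val_class // /MHclass raddf0.
Qed.

Lemma class_val_mul k1 (l1 : {nonneg R}) k2 (l2 : {nonneg R})
    (a : MH X k1 l1) (b : MH X k2 l2) u :
  (k1 + k2 <= 1)%N ->
  class_val (MHmul a b) u = class_val a u * class_val b (shift k1 u).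
Proof. by move=> k12; rewrite class_val_class // ev_cocycle_mul. Qed.

Lemma class_val_simp k (l : {nonneg R}) (a : MH X k l) u :
  class_val a u <> 0 -> is_simp k l u.
Proof.
by move=> au; apply: contrapT => /negP ns; apply: au; exact: ev_nsimp.
Qed.

Lemma class_val_eq_upto k (l : {nonneg R}) (a : MH X k l) u v :
  (forall i, (i <= k)%N -> u i = v i) -> class_val a u = class_val a v.
Proof. exact: ev_eq. Qed.

Definition point_cochain (x : X) : cochain X 0 0%:nng :=
  (lin_ext (fun s => (vert s 0 == x)%:R) : {additive MC X 0 0%:nng -> int}).

Lemma point_cochain_cocycle x : point_cochain x \in @is_cocycle R X 0 0%:nng.
Proof. by rewrite unfold_in; apply/eqP/evP => u; rewrite ev_coboundary0. Qed.

Definition point_class (x : X) : MH X 0 0%:nng :=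
  MHclass (Cocycle (point_cochain_cocycle x)).

Lemma class_val_point x u : class_val (point_class x) u = (u 0 == x)%:R.
Proof.
rewrite class_val_class //.
have /is_simp_simplex[s su] : is_simp 0 0%:nng u.
  by rewrite /is_simp /seqlen big_nil eqxx andbT; apply/nrepP.
by rewrite (ev_val _ su) /= lin_extU -[simplex_tuple s]/(val s) su vert_tup.
Qed.

Lemma class_val_point_neq0 x u : class_val (point_class x) u <> 0 -> u 0 = x.
Proof. by rewrite class_val_point; case: eqP. Qed.

Definition edge_cochain (a b : X) (l : {nonneg R}) : cochain X 1 l :=
  (lin_ext (fun s => ((vert s 0 == a) && (vert s 1 == b))%:R)
     : {additive MC X 1 l -> int}).

Lemma ev_edge_cochain a b l u : is_simp 1 l u ->
  ev (edge_cochain a b l) u = ((u 0 == a) && (u 1 == b))%:R.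
Proof.
move=> /is_simp_simplex[s su].
by rewrite (ev_val _ su) /= lin_extU -[simplex_tuple s]/(val s) su !vert_tup.
Qed.

(** The only face of (u 0, u 1, u 2) that can matter is (u 0, u 2), and only if
    u 1 lies strictly between; this cannot be (a, b). *)
Lemma edge_cochain_cocycle a b l :
  adjacent a b -> edge_cochain a b l \in @is_cocycle R X 1 l.
Proof.
move=> [_ adj]; rewrite unfold_in; apply/eqP/evP => u; rewrite ev0.
have [simp|nsimp] := boolP (is_simp 2 l u); last exact: ev_nsimp.
rewrite ev_coboundary_simp // /bdsum big_nat1.
case: ifP => [al|_]; last by rewrite mulr0.
have [simp1|nsimp1] := boolP (is_simp 1 l (omit 1 u)); last first.
  by rewrite ev_nsimp // mulr0.
rewrite ev_edge_cochain // /omit /bump /=.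
case: andP => [[/eqP u0 /eqP u2]|_]; last by rewrite mulr0.
have /andP[/nrepP nu _] := simp.
have /eqP u01 := nu 0 isT; have /eqP u12 := nu 1 isT.
have {}u0 : u 0 = a := u0; have {}u2 : u 2 = b := u2.
case: (adj (u 1)); rewrite -?u0 -?u2; [exact: nesym|exact: u12|exact/eqP].
Qed.

Lemma adjacent_edge_class a b l : adjacent a b -> dist a b = (l%:num)%:E ->
  exists phi : MH X 1 l,
    MHmul (MHmul (point_class a) phi) (point_class b) <> 0.
Proof.
move=> adj dab; exists (MHclass (Cocycle (edge_cochain_cocycle l adj))).
pose u i := if i is 0 then a else b.
have simp : is_simp 1 l u.
  apply/andP; split; first by apply/nrepP => -[|//] _; apply/eqP; case: adj.
  by rewrite /seqlen big_nat1 dab.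
move=> /(congr1 (fun c => class_val c u)); rewrite class_val0 //.
rewrite !class_val_mul // !class_val_point class_val_class //.
by rewrite [ev _ _](ev_edge_cochain a b simp) /shift /= !eqxx.
Qed.

End LowDegree.

(** * Transport along an isomorphism *)

(** Such a map preserves and reflects the nonvanishing of products, and testing
    products with indicators is how supports are located. *)
Definition graded_embedding (R : realType) (X X' : extQuasiMetric R)
    (F : forall k l, MH X k l -> MH X' k l) : Prop :=
  (forall k l x, F k l x = 0 <-> x = 0) /\
  (forall k1 l1 k2 l2 a b,
    F _ _ (MHmul a b) = MHmul (F k1 l1 a) (F k2 l2 b)).

Lemma bigraded_isomorphic_embeddings (R : realType) (X X' : extQuasiMetric R) :
  bigraded_isomorphic (magnitude_cohomology X) (magnitude_cohomology X') ->
  exists (F : forall k l, MH X k l -> MH X' k l)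
         (G : forall k l, MH X' k l -> MH X k l),
    [/\ graded_embedding F, graded_embedding G,
        forall k l, cancel (F k l) (G k l) & forall k l, cancel (G k l) (F k l)].
Proof.
move=> [f [fbij _ fM]].
have inv k l : exists g : MH X' k l -> MH X k l,
      cancel (f k l) g /\ cancel g (f k l).
  by have [g fK gK] := fbij k l; exists g.
pose G k l := projT1 (cid (inv k l)).
have fK k l : cancel (f k l) (G k l) by rewrite /G; case: cid => g [].
have gK k l : cancel (G k l) (f k l) by rewrite /G; case: cid => g [].
have f0 k l : f k l 0 = 0 by exact: raddf0.
exists (fun k l => f k l), G; split=> //; split=> //.
- move=> k l x; split=> [fx0|->]; last exact: f0.
  by rewrite -[x]fK fx0 -[in LHS](f0 k l) fK.
- move=> k l x; split=> [gx0|->]; first by rewrite -[x]gK gx0 f0.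
  by rewrite -(f0 k l) fK.
- move=> k1 l1 k2 l2 a b.
  by apply: (can_inj (fK _ _)); rewrite fM !gK.
Qed.

Section Correspondence.
Variables (R : realType) (X X' : extQuasiMetric R).
Implicit Types F : forall k l, MH X k l -> MH X' k l.

(** The point a' lies in the support of the image of the indicator of a. *)
Definition corr F (a : X) (a' : X') :=
  class_val (F 0 0%:nng (point_class a)) (fun=> a') <> 0.

Lemma corr_point F (a : X) u :
  class_val (F 0 0%:nng (point_class a)) u <> 0 -> corr F a (u 0).
Proof.
rewrite (class_val_eq_upto (v := fun=> u 0) _) // => i.
by rewrite leqn0 => /eqP->.
Qed.

Lemma corr_total F (FE : graded_embedding F) a : exists a', corr F a a'.
Proof.
have [|u /corr_point] := @class_val_neq0 _ _ _ _ (F 0 0%:nng (point_class a)).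
  move=> /(FE.1 0 0%:nng) /(congr1 (fun c => class_val c (fun=> a))).
  by rewrite class_val0 // class_val_point eqxx.
by exists (u 0).
Qed.

(** F [point_class a] and F [point_class b] share a point of their supports, so
    their product, which is F of the product of two indicators, is not 0. *)
Lemma corr_inj F (FE : graded_embedding F) a b a' :
  corr F a a' -> corr F b a' -> a = b.
Proof.
rewrite /corr => Fa Fb; apply: contrapT => ab.
have ab0 : MHmul (point_class a) (point_class b) = 0.
  apply: class_val_eq0 => u; rewrite class_val_mul // !class_val_point /shift.
  by case: eqP => [->|_]; [case: eqP|rewrite mul0r].
have [F0 FM] := FE.
have := FM _ _ _ _ (point_class a) (point_class b).
rewrite ab0 (F0 _ _ _).2 // => /(congr1 (fun c => class_val c (fun=> a'))).
rewrite class_val0 // class_val_mul // => /esym/eqP.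
by rewrite mulf_eq0 => /orP[] /eqP.
Qed.

(** The product of F [point_class a], the image of an edge class of degree
    (1, dist a b) and F [point_class b] is not 0. A simplex on which it does not
    vanish runs from a' to b', because [corr F] is functional, and has length
    dist a b, because the middle factor does not vanish on it. *)
Lemma adjacent_dist_corr F (FE : graded_embedding F) a b a' b' :
  (forall x p q, corr F x p -> corr F x q -> p = q) ->
  adjacent a b -> (dist a b < +oo)%E -> corr F a a' -> corr F b b' ->
  dist a' b' = dist a b.
Proof.
move=> funF adj dfin aa' bb'; have [F0 FM] := FE.
have [l dab] : exists l : {nonneg R}, dist a b = (l%:num)%:E.
  move: (dist a b) (dist_ge0 a b) dfin => [x| |] // x0 _.
  by exists (NngNum x0).
have [phi phi0] := adjacent_edge_class adj dab.
have Fphi0 : MHmul (MHmul (F _ _ (point_class a)) (F _ _ phi))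
    (F _ _ (point_class b)) <> 0.
  move=> F0'; apply: phi0; apply/(F0 _ _ _).1.
  by rewrite (FM _ _ _ _ (MHmul (point_class a) phi)) (FM _ _ _ _ _ phi).
have [u] := class_val_neq0 Fphi0; rewrite !class_val_mul // => /eqP.
rewrite !mulf_eq0 !negb_or => /andP[/andP[/eqP ua /eqP uphi] /eqP ub].
have /andP[_ /eqP] := class_val_simp uphi.
rewrite /seqlen big_nat1 => dl.
by rewrite (funF _ _ _ aa' (corr_point ua)) (funF _ _ _ bb' (corr_point ub)) dl.
Qed.

Lemma dist_corr_le F (FE : graded_embedding F) a b a' b' :
  (0 < separation X)%E ->
  (forall x p q, corr F x p -> corr F x q -> p = q) ->
  corr F a a' -> corr F b b' -> (dist a' b' <= dist a b)%E.
Proof.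
move=> sepX funF aa' bb'; have [dab|] := ltP (dist a b) +oo%E; last first.
  by rewrite leye_eq => /eqP->; exact: leey.
move: a' b' aa' bb'; elim/(geodesic_ind sepX): a b / dab => [a|a b adj|a b c].
- move=> p q ap aq; rewrite (funF _ _ _ ap aq).
  by rewrite (dist_eq0 _ _).2 // dist_ge0.
- by move=> dfin p q ap bq; rewrite (adjacent_dist_corr FE funF adj dfin ap bq).
- move=> dab IHac IHcb p q ap bq; have [r cr] := corr_total FE c.
  rewrite dab (le_trans (dist_triangle p r q)) // leeD //; [exact: IHac|].
  exact: IHcb.
Qed.

End Correspondence.

(** Being supported at a' is symmetric in a and a': it says that
    [point_class a'] times F [point_class a] is not 0, and G maps this product
    to the product of G [point_class a'] and [point_class a]. *)
Lemma corr_sym (R : realType) (X X' : extQuasiMetric R)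
    (F : forall k l, MH X k l -> MH X' k l)
    (G : forall k l, MH X' k l -> MH X k l) a a' :
  graded_embedding G ->
  (forall k l, cancel (F k l) (G k l)) ->
  corr F a a' -> corr G a' a.
Proof.
move=> [G0 GM] FK Faa'.
have : MHmul (point_class a') (F _ _ (point_class a)) <> 0.
  move=> /(congr1 (fun c => class_val c (fun=> a'))).
  rewrite class_val0 // class_val_mul // class_val_point eqxx mul1r.
  exact: Faa'.
move=> ne0; have : MHmul (G _ _ (point_class a')) (point_class a) <> 0.
  rewrite -[point_class a]FK => G0'; apply: ne0; apply/(G0 _ _ _).1.
  by rewrite (GM _ _ _ _ (point_class a')).
move=> /class_val_neq0[u]; rewrite class_val_mul // => /eqP.
rewrite mulf_eq0 negb_or => /andP[/eqP Ga' /eqP /class_val_point_neq0 <-].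
exact: corr_point Ga'.
Qed.

Theorem theorem3p1 (R : realType) (X X' : extQuasiMetric R)
    (sepX : (0 < separation X)%E) (sepX' : (0 < separation X')%E)
    (isoMH : bigraded_isomorphic (magnitude_cohomology X)
                                 (magnitude_cohomology X')) :
  isometric X X'.
Proof.
have [F [G [FE GE FK GK]]] := bigraded_isomorphic_embeddings isoMH.
have FG a a' : corr F a a' -> corr G a' a by exact: corr_sym.
have GF a a' : corr G a' a -> corr F a a' by exact: corr_sym.
have funF a p q : corr F a p -> corr F a q -> p = q.
  by move=> /FG ap /FG aq; exact: (corr_inj GE ap aq).
have funG a' p q : corr G a' p -> corr G a' q -> p = q.
  by move=> /GF ap /GF aq; exact: (corr_inj FE ap aq).
have [f fP] := choice (corr_total FE).
have [g gP] := choice (corr_total GE).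
exists f; split.
  exists g => x; first exact: funG (gP _) (FG _ _ (fP x)).
  exact: funF (fP _) (GF _ _ (gP x)).
move=> a b; apply/eqP; rewrite eq_le; apply/andP; split.
  exact: (dist_corr_le FE sepX funF).
exact: (dist_corr_le GE sepX' funG (FG _ _ (fP a)) (FG _ _ (fP b))).
Qed.
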